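(* For every $\alpha\in\mathbb{R}$ and every $m\in\mathbb{N}$, we have $\alpha\in\mathcal{H}_m$ if and only if $m\alpha\in\widehat{\mathcal{H}}_m$.
   Context: $\mathbb{N}$ denotes the positive integers, $[x]$ the integer part (floor) of $x\in\mathbb{R}$, and $\langle x\rangle=x-[x]$ the fractional part. For $m\in\mathbb{N}$, $$\mathcal{H}_m=\Big\{\alpha\in\mathbb{R}\;:\;\mathrm{card}\{1\le k\le n : \langle k\alpha\rangle<\tfrac1m\}\ge \tfrac nm\ \text{ for all } n\in\mathbb{N}\Big\},$$ $$\widehat{\mathcal{H}}_m=\Big\{\alpha\in\mathbb{R}\;:\;\mathrm{card}\{1\le k\le n : [k\alpha]\in m\mathbb{Z}\}\ge \tfrac nm\ \text{ for all } n\in\mathbb{N}\Big\}.$$ *)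

(* Defs.v *)
From mathcomp Require Import all_boot all_order all_algebra.
From mathcomp Require Import classical_sets reals.

Set Implicit Arguments.
Unset Strict Implicit.
Unset Printing Implicit Defensive.

Import Order.TTheory GRing.Theory Num.Theory.
Local Open Scope classical_set_scope.
Local Open Scope ring_scope.

Definition fracpart (R : realType) (x : R) : R := x - (Num.floor x)%:~R.

Definition calH {R : realType} (m : nat) : set R :=
  [set alpha : R | forall n : nat, (0 < n)%N ->
     n%:R / m%:R
       <= #|[pred k : 'I_n.+1 | (1 <= k <= n)%N
                              & fracpart (k%:R * alpha) < 1 / m%:R]|%:R :> R].

Definition calHhat {R : realType} (m : nat) : set R :=
  [set alpha : R | forall n : nat, (0 < n)%N ->
     n%:R / m%:R
       <= #|[pred k : 'I_n.+1 | (1 <= k <= n)%N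
                              & (m %| Num.floor (k%:R * alpha))%Z]|%:R :> R].

(* Main.v *)
Require Import Defs.
From mathcomp Require Import all_boot all_order all_algebra.
From mathcomp Require Import classical_sets reals.

(** The two counting conditions agree term by term. Since
    m x = m [x] + m <x> with 0 <= m <x> < m, the residue of [m x] modulo m is
    [m <x>], which vanishes exactly when <x> < 1/m
    ([fracpart_lt_invE]). Taking x = k alpha, for each k, shows that the two
    cardinals coincide for every n. *)

Import Order.TTheory GRing.Theory Num.Theory.

Local Open Scope classical_set_scope.
Local Open Scope ring_scope.

(** Both sides say that q <= x < q + 1/m for some integer q: on the left q is
    the floor of x by definition, on the right m q is the floor of m x, and
    1/m <= 1 forces q to be the floor of x again. *)
Lemma fracpart_lt_invE (R : realType) (m : nat) (x : R) : (0 < m)%N ->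
  (fracpart x < 1 / m%:R) = (m %| Num.floor (m%:R * x))%Z.
Proof.
move=> m_gt0; have mR_gt0 : 0 < m%:R :> R by rewrite ltr0n.
have fracE : (fracpart x < 1 / m%:R) = (m%:R * x < m%:R * (Num.floor x)%:~R + 1).
  by rewrite /fracpart ltr_pdivlMr // mulrC mulrBr ltrBlDl.
rewrite fracE; apply/idP/dvdzP => [lt_mx | [q floor_mx]].
  exists (Num.floor x); apply: floor_def.
  rewrite !intrD !intrM mulrC ler_pM2l //.
  by rewrite lt_mx andbT; exact: floor_le.
have /andP[le_q lt_q] := floor_itv (m%:R * x).
move: le_q lt_q; rewrite floor_mx intrD intrM mulrC ler_pM2l // => le_q lt_q.
suff -> : Num.floor x = q by [].
apply: floor_def; rewrite le_q intrD -(ltr_pM2l mR_gt0) mulrDr mulr1 /=.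
by apply: lt_le_trans lt_q _; rewrite lerD2l ler1n.
Qed.

Theorem theorem2 (R : realType) (alpha : R) (m : nat) (hm : (0 < m)%N) :
  alpha \in calH m <-> m%:R * alpha \in calHhat m.
Proof.
have cardE n :
    #|[pred k : 'I_n.+1 | (1 <= k <= n)%N & fracpart (k%:R * alpha) < 1 / m%:R]|
  = #|[pred k : 'I_n.+1 | (1 <= k <= n)%N
                        & (m %| Num.floor (k%:R * (m%:R * alpha)))%Z]|.
  by apply: eq_card => k; rewrite !inE fracpart_lt_invE // mulrCA.
by rewrite !inE; split=> count_ge n n_gt0; have := count_ge n n_gt0; rewrite cardE.
Qed.
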